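(* Let $(G,R)$ be a finite rooted graph without sinks such that $t^{-1}(R)=\emptyset$. If the unfolding tree $\mathcal{T}(G,R)$ is cocompact, then $(G,R)$ admits an actual labelling.
   Context: A graph $G=(VG,EG,o,t)$ is a directed multigraph (loops and multiple edges allowed) with origin and terminus maps $o,t:EG\to VG$. A sink is a vertex $v$ with $o^{-1}(v)=\emptyset$. A path is either an empty path $\varepsilon_v$ or a finite sequence $e_1\cdots e_n$ of edges with $t(e_i)=o(e_{i+1})$; $O(p),T(p)$ denote its origin and terminus. A rooted graph $(G,R)$ is a graph with a vertex $R$ from which every vertex is reachable by a directed path. A rooted tree is a graph with a vertex $R$ such that every vertex has a unique path from $R$. The unfolding tree $\mathcal{T}(G,R)$ has as vertices the paths $p$ with $O(p)=R$ and an edge $(p,pe)$ from $p$ to $pe$ for each such $p$ and each edge $e$ with $o(e)=T(p)$. For a rooted tree $\mathcal{T}$ with root $R$ and vertex $v$, $\mathcal{T}^v$ is obtained by reversing every edge on the path from $R$ to $v$ (a rooted tree with root $v$). $\cong$ is isomorphism of directed graphs. A rooted tree $\mathcal{T}$ is cocompact if there are a finite set $F$ and $l:V\mathcal{T}\to F$ with $l(v)=l(w)\Rightarrow \mathcal{T}^v\cong\mathcal{T}^w$. Multisets over a set $X$ have positive integer multiplicities; union adds multiplicities; $M\setminus\{x\}$ removes one copy. $t_m(o^{-1}(v))$ is the multiset of termini of edges leaving $v$, counted with the number of edges, and $l(t_m(o^{-1}(v)))$ its multiset of labels. Actual labelling of a rooted graph $(G,R)$ with $t^{-1}(R)=\emptyset$: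 a finite set $X$, maps $l:VG\to X$, $l_p:VG\setminus\{R\}\to X$, and multisets $M_x$ over $X$ ($x\in X$) such that for every $v\ne R$: (1) $l_p(v)\in M_{l(v)}$; (2) $l(t_m(o^{-1}(v)))=M_{l(v)}\setminus\{l_p(v)\}$; (3) $l(o(e))=l_p(v)$ for every edge $e$ with $t(e)=v$; and (4) $l(t_m(o^{-1}(R)))=M_{l(R)}$. *)

(* Defs.v *)
From HB Require Import structures.
From mathcomp Require Import all_boot.
From mathcomp Require Import finmap multiset boolp.
From Stdlib Require List.

Set Implicit Arguments.
Unset Strict Implicit.
Unset Printing Implicit Defensive.

(* Directed multigraphs, possibly infinite (unfolding trees are). *)
Record digraph := Digraph {
  vertex : Type;
  edge : Type;
  org : edge -> vertex;
  ter : edge -> vertex }.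

Record fin_digraph := FinDigraph {
  fvertex : finType;
  fedge : finType;
  forg : fedge -> fvertex;
  fter : fedge -> fvertex }.

Coercion digraph_of_fin (G : fin_digraph) : digraph :=
  Digraph (@forg G) (@fter G).

Section Paths.
Variable G : digraph.

Definition sink (v : vertex G) : Prop := forall e : edge G, org e <> v.

(* A path is given by its origin [u] and its sequence of edges [p]; the empty
   path at [u] is the pair [u], [[::]]. *)
Fixpoint path_from (u : vertex G) (p : seq (edge G)) : Prop :=
  if p is e :: p' then org e = u /\ path_from (ter e) p' else True.

Definition path_end (u : vertex G) (p : seq (edge G)) : vertex G :=
  last u (map (@ter G) p).

Definition path_to (u : vertex G) (p : seq (edge G)) (v : vertex G) : Prop :=
  path_from u p /\ path_end u p = v.

Definition is_rooted (R : vertex G) : Prop :=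
  forall v, exists p, path_to R p v.

Definition is_rooted_tree (R : vertex G) : Prop :=
  forall v, exists! p, path_to R p v.

Lemma path_from_rcons u p e :
  path_from u (rcons p e) <-> path_from u p /\ org e = path_end u p.
Proof.
elim: p u => [|f p IH] u /=; first by split => -[].
by rewrite IH; split => [[? []]|[[]]].
Qed.

End Paths.

Record rooted_tree := RootedTree {
  tree_graph :> digraph;
  root : vertex tree_graph;
  rooted_treeP : is_rooted_tree root }.

Definition digraph_iso (G H : digraph) : Prop :=
  exists (f : vertex G -> vertex H) (g : edge G -> edge H),
    [/\ bijective f, bijective g,
        forall e, org (g e) = f (org e)
      & forall e, ter (g e) = f (ter e)].

(* [reroot T v] is the tree T^v. *)
Definition on_root_path (T : rooted_tree) (v : vertex T) (e : edge T) : Prop :=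
  exists p, path_to (root T) p v /\ List.In e p.

Definition reroot (T : rooted_tree) (v : vertex T) : digraph :=
  Digraph
    (fun e : edge T => if `[< on_root_path v e >] then ter e else org e)
    (fun e : edge T => if `[< on_root_path v e >] then org e else ter e).

Definition cocompact (T : rooted_tree) : Prop :=
  exists (F : finType) (l : vertex T -> F),
    forall v w, l v = l w -> digraph_iso (reroot v) (reroot w).

Lemma sig_eqP (A : Type) (P : A -> Prop) (x y : {a | P a}) :
  sval x = sval y -> x = y.
Proof. by case: x y => [x px] [y py] /= xy; exact: eq_exist. Qed.

Section Unfolding.
Variables (G : digraph) (R : vertex G).

Definition unf_vertex : Type := {p : seq (edge G) | path_from R p}.

Definition unf_end (p : unf_vertex) : vertex G := path_end R (sval p).

(* The edge (p, pe) is encoded by the pair of [p] and [e]. *)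
Definition unf_edge : Type :=
  {pe : unf_vertex * edge G | org pe.2 = unf_end pe.1}.

Definition unf_org (x : unf_edge) : unf_vertex := (sval x).1.

Definition unf_ter (x : unf_edge) : unf_vertex :=
  exist _ (rcons (sval (sval x).1) (sval x).2)
    (proj2 (path_from_rcons R (sval (sval x).1) (sval x).2)
       (conj (svalP (sval x).1) (svalP x))).

Definition unf_graph : digraph := Digraph unf_org unf_ter.

Definition unf_root : vertex unf_graph :=
  exist (fun p : seq (edge G) => path_from R p) [::] I.

Lemma unf_path_label (u v : vertex unf_graph) (s : seq (edge unf_graph)) :
  path_to u s v ->
  sval v = sval u ++ [seq (sval x).2 | x : unf_edge <- s].
Proof.
case; elim: s u => [|x s IH] u /=; first by move=> _ <-; rewrite cats0.
move=> [<- xs] sv; rewrite (IH _ xs sv) /= -cats1 -catA //.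
Qed.

Lemma unf_path_inj (u v : vertex unf_graph) (s s' : seq (edge unf_graph)) :
  path_to u s v -> path_to u s' v -> s = s'.
Proof.
move=> us us'.
have : [seq (sval x).2 | x : unf_edge <- s]
     = [seq (sval x).2 | x : unf_edge <- s'].
  have := unf_path_label us'; rewrite (unf_path_label us).
  by move=> /(congr1 (drop (size (sval u)))); rewrite !drop_size_cat.
case: us us' => + _ [+ _].
elim: s s' u => [|x s IH] [|x' s'] u //= [ux xs] [ux' xs'] [exx ess].
have exx' : x = x'.
  apply: sig_eqP.
  have : (sval x).1 = (sval x').1 by exact: (etrans ux (esym ux')).
  by move: exx; case: (sval x) => ? ?; case: (sval x') => ? ? /= -> ->.
rewrite exx' in xs *; congr (_ :: _); exact: IH xs xs' ess.
Qed.

Lemma unf_rooted_tree : is_rooted_tree unf_root.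
Proof.
case=> p; elim/last_ind: p => [|p e IH] hp.
  exists [::]; split; first by split=> //; exact: sig_eqP.
  by move=> s; apply: unf_path_inj; split=> //; exact: sig_eqP.
have [hp0 he] := (proj1 (path_from_rcons R p e) hp).
have [s [[sR se] _]] := IH hp0.
pose x : edge unf_graph :=
  exist (fun pe : unf_vertex * edge G => org pe.2 = unf_end pe.1)
    (exist _ p hp0, e) he.
have sx : path_to unf_root (rcons s x) (exist _ (rcons p e) hp).
  split; first by apply/path_from_rcons; split=> //; rewrite se.
  by rewrite /path_end map_rcons last_rcons; exact: sig_eqP.
by exists (rcons s x); split=> // s'; exact: unf_path_inj.
Qed.

Definition unfolding_tree : rooted_tree := RootedTree unf_rooted_tree.

End Unfolding.

Section ActualLabelling.
Variables (G : fin_digraph) (R : vertex G).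
Local Open Scope mset_scope.

(* t_m(o^{-1}(v)): the out-neighbours of [v], with edge multiplicities. *)
Definition out_mset (v : fvertex G) : {mset fvertex G} :=
  seq_mset [seq fter e | e <- enum (fedge G) & forg e == v].

(* The image of a multiset, adding up multiplicities. *)
Definition mset_image (A B : choiceType) (f : A -> B) (M : {mset A}) :
  {mset B} := seq_mset [seq f a | a <- M].

Definition is_actual_labelling (X : finType) (l : fvertex G -> X)
    (lp : {v : fvertex G | v != R} -> X) (M : X -> {mset X}) : Prop :=
  (forall v : {v : fvertex G | v != R},
     [/\ lp v \in M (l (val v)),
         mset_image l (out_mset (val v)) = M (l (val v)) `\ lp v
       & forall e : fedge G, fter e = val v -> l (forg e) = lp v])
  /\ mset_image l (out_mset R) = M (l R).

Definition has_actual_labelling : Prop :=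
  exists (X : finType) (l : fvertex G -> X)
    (lp : {v : fvertex G | v != R} -> X) (M : X -> {mset X}),
    is_actual_labelling l lp M.

End ActualLabelling.

(* Main.v *)
(* Colour each vertex of the undirected unfolding tree by its ball of radius n,
   coded by colour refinement.  Cocompactness bounds the number of colours
   uniformly in n, so at some N the colour determines the multiset of colours of
   the neighbours.  Two paths p, p' with the same end carry isomorphic cones, and
   at depth at least N in these cones the colours agree.  Without sinks the
   agreement propagates upwards: the colour of a parent is what is left of the
   neighbour colours after removing the children.  So the stable colour of a
   path depends only on its end and yields the labelling l, the colour of the
   parent yields l_p, and the neighbour colours yield M. *)
Require Import Defs.
From mathcomp Require Import all_boot.
From mathcomp Require Import finmap multiset boolp.
From Stdlib Require List.

Set Implicit Arguments.
Unset Strict Implicit.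
Unset Printing Implicit Defensive.

(** * Rerooted trees *)

Section Paths.
Variable G : digraph.
Implicit Types (u v : vertex G) (p q : seq (edge G)).

Lemma path_from_cat u p q :
  path_from u (p ++ q) <-> path_from u p /\ path_from (path_end u p) q.
Proof.
elim: p u => [|e p IH] u /=; first by split=> [|[]].
by rewrite IH; split=> [[? []]|[[]]].
Qed.

Lemma path_end_cat u p q : path_end u (p ++ q) = path_end (path_end u p) q.
Proof. by rewrite /path_end map_cat last_cat. Qed.

Lemma path_end_rcons u p e : path_end u (rcons p e) = ter e.
Proof. by rewrite /path_end map_rcons last_rcons. Qed.

Lemma path_to_rcons u p e : path_to u p (org e) -> path_to u (rcons p e) (ter e).
Proof.
by case=> up pe; split; [apply/path_from_rcons|rewrite path_end_rcons].
Qed.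

Lemma path_edge_next u p e :
  path_from u p -> List.In e p ->
  ter e = path_end u p \/ exists2 e', List.In e' p & org e' = ter e.
Proof.
elim: p u => //= f p IH u [_ fp] [<-|ep]; last first.
  have [?|[e' e'p ?]] := IH _ fp ep; first by left.
  by right; exists e' => //; right.
case: p fp {IH} => [|g p] /=; first by left.
by case=> gf _; right; exists g => //; right; left.
Qed.

End Paths.

(** [digraph_iso] does not mention roots. An isomorphism of rerooted trees respects them all the
    same, because the new root is the unique source. *)
Lemma reroot_source (T : rooted_tree) (v u : vertex T) :
  (forall e : edge (reroot v), ter e <> u) <-> u = v.
Proof.
split; last first.
  move=> -> e /=; case: asboolP => [[p [[Rp pv] ep]] ev|ne ev].
    have [p1 [p2 def_p]] := List.in_split e p ep.
    have Rp' : path_from (Defs.root T) (p1 ++ e :: p2) by rewrite -[_ ++ _]def_p.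
    have [Rp1 [ep1 _]] := proj1 (path_from_cat _ _ _) Rp'.
    (* A reversed edge entering [v] left [v] originally, so the proper prefix [p1] of [p] would be a
       second path to [v]. *)
    have [q [_ q_uniq]] := rooted_treeP v.
    have e1 : q = p1 by apply: q_uniq; split=> //; rewrite -ep1.
    have e2 : q = p by apply: q_uniq.
    have := congr1 size (etrans (esym e1) (etrans e2 def_p)).
    rewrite [size (p1 ++ e :: p2)%list](size_cat p1 (e :: p2)) /=.
    by move/eqP; rewrite -[X in X == _]addn0 eqn_add2l.
  (* An unreversed edge entering [v] would end a root path to [v], and so would have been
     reversed. *)
  have [s [Rs _]] := rooted_treeP (@org T e).
  apply: ne; exists (rcons s e); split; first by rewrite -[v]ev; exact: (path_to_rcons (G := T)).
  by rewrite -cats1; apply: List.in_or_app; right; left.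
move=> no_in; apply: contrapT => uv.
have [p [[Rp pv] p_uniq]] := rooted_treeP v.
have no_out e : List.In e p -> org e <> u.
  move=> ep eu; apply: (no_in e) => /=; rewrite asboolT //.
  by exists p.
have [s [[Rs su] _]] := rooted_treeP u.
case/lastP: s Rs su => [|s e] Rs su.
  move: su; rewrite /path_end /= => Ru.
  case: p Rp pv no_out {p_uniq} => [|e p] /= [].
    by rewrite /path_end /= => vR _; apply: uv; rewrite -Ru -vR.
  by move=> eR _ _ /(_ e (or_introl erefl)); apply; rewrite eR.
(* The last edge into [u] must be reversed, so it lies on [p]. Then [u] is either [v] or the origin
   of the next edge of [p], and both are excluded. *)
rewrite path_end_rcons in su.
apply: (no_in e) => /=; case: asboolP => // -[p' [Rp' ep']].
have def_p' : p = p' by apply: p_uniq.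
rewrite -def_p' in ep'.
have [ev|[e' e'p e'e]] := path_edge_next Rp ep'.
  by case: uv; rewrite -su ev.
by case: (no_out e' e'p); rewrite e'e.
Qed.

(** * Colour refinement on the unfolding tree *)

Lemma perm_map_factor (A : Type) (B C : eqType) (c : A -> B) (d : A -> C)
    (s t : seq A) :
  (forall x y, c x = c y -> d x = d y) ->
  perm_eq (map c s) (map c t) -> perm_eq (map d s) (map d t).
Proof.
move=> cd; case: s => [|a s]; first by case: t => [|b t] // /perm_size.
have /choice[g gP] : forall k, exists m, forall x, c x = k -> d x = m.
  move=> k; have [[x xk]|nk] := pselect (exists x, c x = k).
    by exists (d x) => y yk; apply: cd; rewrite yk.
  (* Outside the image of [c] the factor takes the default [d a], which is why the empty list was
     treated apart. *)
  by exists (d a) => y yk; case: nk; exists y.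
have dE r : map d r = map g (map c r).
  by rewrite -map_comp; apply: eq_map => x /=; apply: gP.
by rewrite !dE; exact: perm_map.
Qed.

Lemma decreasing_set_stable (F : finType) (S : nat -> {set F}) :
  (forall n, S n.+1 \subset S n) -> exists n, S n.+1 = S n.
Proof.
move=> decS.
suff: forall k n, #|S n| <= k -> exists n, S n.+1 = S n by move/(_ _ 0); apply.
elim=> [|k IH] n Sn.
  exists n; apply/eqP; rewrite eqEcard decS /=.
  exact: leq_trans Sn _.
have [eqS|neqS] := eqVneq (S n.+1) (S n); first by exists n.
apply: (IH n.+1); rewrite -ltnS; apply: leq_trans Sn; apply: proper_card.
by rewrite properEneq neqS decS.
Qed.

Section Colors.
Variables (G : fin_digraph) (R : fvertex G).
Local Notation E := (fedge G).
Local Notation fend p := (@path_end G R p : fvertex G).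
Local Notation is_path p := (@path_from G R p).
Implicit Types p q : seq E.

(** Tree vertices are handled as bare edge sequences, which avoids subset types; [is_path] is
    assumed only where it matters. *)
Definition parent p := take (size p).-1 p.
Definition children p := [seq rcons p e | e <- enum E & forg e == fend p].
Definition neighbors p :=
  (if p is [::] then [::] else [:: parent p]) ++ children p.

Lemma parent_rcons p e : parent (rcons p e) = p.
Proof. by rewrite /parent size_rcons -cats1 take_size_cat. Qed.

Lemma mem_children p q :
  reflect (exists2 e, forg e = fend p & q = rcons p e) (q \in children p).
Proof.
apply: (iffP mapP) => [[e]|[e ep ->]].
  by rewrite mem_filter => /andP[/eqP ep _] ->; exists e.
by exists e => //; rewrite mem_filter mem_enum andbT; apply/eqP.
Qed.

Lemma neighbors_rcons p e :
  neighbors (rcons p e) = p :: children (rcons p e).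
Proof. by rewrite /neighbors parent_rcons; case: p. Qed.

Lemma mem_neighbors p q :
  q \in neighbors p <->
  (exists2 e, forg e = fend p & q = rcons p e) \/ exists e, p = rcons q e.
Proof.
split=> [|[/mem_children qp|[e ->]]].
- case/lastP: p => [/mem_children|p e]; first by left.
  rewrite neighbors_rcons inE => /orP[/eqP -> |/mem_children]; last by left.
  by right; exists e.
- by rewrite mem_cat qp orbT.
by rewrite neighbors_rcons mem_head.
Qed.

Lemma neighbors_uniq p : uniq (neighbors p).
Proof.
have uc : uniq (children p).
  by rewrite map_inj_uniq; [apply: filter_uniq; exact: enum_uniq|exact: rcons_injr].
case/lastP: p uc => // p e uc; rewrite neighbors_rcons /= uc andbT.
apply/mem_children => -[f _ /(congr1 size)/eqP].
by rewrite !size_rcons ltn_eqF // ltnS leqnSn.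
Qed.

Lemma neighbors_path p q : is_path p -> q \in neighbors p -> is_path q.
Proof.
move=> Rp /mem_neighbors[[e ep ->]|[e def_p]].
  exact/(path_from_rcons (G := G)).
by move: Rp; rewrite def_p => /path_from_rcons[].
Qed.

(* [color n p] codes the isomorphism type of the ball of radius [n] around [p]
   in the undirected unfolding tree. *)
Fixpoint color n p : nat :=
  if n is n'.+1 then
    choice.pickle (sort leq [seq color n' q | q <- neighbors p])
  else 0.

Lemma colorS n p q :
  color n.+1 p = color n.+1 q <->
  perm_eq [seq color n r | r <- neighbors p] [seq color n r | r <- neighbors q].
Proof.
have leqP := perm_sortP leq_total leq_trans anti_leq.
split=> [/(pcan_inj choice.pickleK)/leqP // | /leqP eq_sort].
by rewrite /= eq_sort.
Qed.

Lemma color_refine n p q : color n.+1 p = color n.+1 q -> color n p = color n q.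
Proof.
elim: n p q => // n IH p q /colorS pq; apply/colorS.
exact: perm_map_factor IH pq.
Qed.

Local Notation T := (unfolding_tree (G := G) R).

Lemma neighbors_edge (x y : vertex T) :
  (sval y : seq E) \in neighbors (sval x) <->
  exists e : edge T, org e = x /\ ter e = y \/ org e = y /\ ter e = x.
Proof.
split.
  move/mem_neighbors => [[e ex yE]|[e xE]].
    exists (exist (fun pe : unf_vertex (G := G) R * edge G => org pe.2 = unf_end pe.1)
      (x, e) ex); left; split=> //; apply: sig_eqP; exact: esym yE.
  have ey : @org G e = unf_end y.
    have := svalP x; rewrite [X in path_from _ X]xE.
    by move/path_from_rcons=> [].
  exists (exist (fun pe : unf_vertex (G := G) R * edge G => org pe.2 = unf_end pe.1)
      (y, e) ey); right; split=> //; apply: sig_eqP; exact: esym xE.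
case=> -[[p e] /= ep] [[<- <-]|[<- <-]]; apply/mem_neighbors => /=.
  by left; exists e.
by right; exists e.
Qed.

(** Rerooting keeps undirected adjacency, the only structure that colours see. *)
Lemma reroot_edge (v x y : vertex T) :
  (exists e : edge T, org e = x /\ ter e = y \/ org e = y /\ ter e = x) <->
  (exists e : edge (reroot v),
     org e = x /\ ter e = y \/ org e = y /\ ter e = x).
Proof.
by split=> -[e xy]; exists e; move: xy => /=; case: asboolP => _; tauto.
Qed.

Lemma color_iso n (f f' : vertex T -> vertex T) (x : vertex T) :
  cancel f f' -> cancel f' f ->
  (forall x y : vertex T, (sval (f y) : seq E) \in neighbors (sval (f x)) <->
     (sval y : seq E) \in neighbors (sval x)) ->
  color n (sval (f x)) = color n (sval x).
Proof.
move=> fK f'K f_nbr; elim: n x => // n IH x; apply/colorS.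
(* [h] extends [f] to all edge sequences, with a dummy value off paths, so that it can be mapped
   over [neighbors]. *)
pose h p : seq E :=
  if pselect (is_path p) is left Rp then sval (f (exist _ p Rp)) else [::].
have hE (y : vertex T) : h (sval y) = sval (f y).
  rewrite /h; case: pselect => [Ry|]; last by have := svalP y.
  by congr (sval (f _)); exact: sig_eqP.
have nbr_sval (y : vertex T) q : q \in neighbors (sval y) -> exists z : vertex T, sval z = q.
  by move=> qy; exists (exist _ q (neighbors_path (svalP y) qy)).
have h_nbr : perm_eq (neighbors (sval (f x))) (map h (neighbors (sval x))).
  apply: uniq_perm; first exact: neighbors_uniq.
    rewrite map_inj_in_uniq ?neighbors_uniq // => p q.
    move=> /nbr_sval[y <-] /nbr_sval[z <-]; rewrite !hE => /sig_eqP fyz.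
    by rewrite (can_inj fK fyz).
  move=> q; apply/idP/mapP => [qfx|[p px ->]].
    have [z zq] := nbr_sval _ _ qfx.
    exists (sval (f' z)); last by rewrite hE f'K.
    by apply/f_nbr; rewrite f'K [sval z]zq.
  have [z zp] := nbr_sval _ _ px.
  by rewrite -zp hE; apply/f_nbr; rewrite [sval z]zp.
rewrite (permPl (perm_map _ h_nbr)) -map_comp.
suff -> : map (color n \o h) (neighbors (sval x)) =
          map (color n) (neighbors (sval x)) by [].
by apply/eq_in_map => p /nbr_sval[y <-] /=; rewrite hE.
Qed.

Lemma color_reroot n (v w : vertex T) :
  digraph_iso (reroot v) (reroot w) -> color n (sval v) = color n (sval w).
Proof.
case=> f [g [[f' fK f'K] [g' gK g'K] fo ft]].
have fv : f v = w.
  apply/reroot_source => e et.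
  apply: (proj2 (reroot_source v v) erefl (g' e)).
  by apply: (can_inj fK); rewrite -ft g'K.
rewrite -fv; apply/esym/(color_iso _ _ fK f'K) => x y.
split=> /neighbors_edge xy; apply/neighbors_edge.
  apply/(reroot_edge v); move/(reroot_edge w): xy => -[e xy].
  exists (g' e); rewrite -(g'K e) !fo !ft in xy.
  by case: xy => -[/(can_inj fK) -> /(can_inj fK) ->]; [left|right].
apply/(reroot_edge w); move/(reroot_edge v): xy => -[e xy].
exists (g e); rewrite fo ft.
by case: xy => -[-> ->]; [left|right].
Qed.

(** The pairs of labels realised by two vertices of equal colour form a set that shrinks as the
    radius grows. It lives in the finite type [F * F], so it stops shrinking at some step. *)
Lemma cocompact_color_stable :
  cocompact T ->
  exists N, forall p q, is_path p -> is_path q ->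
    color N p = color N q -> color N.+1 p = color N.+1 q.
Proof.
case=> F [l lP].
have l_color n v w : l v = l w -> color n (sval v) = color n (sval w).
  by move/lP; exact: color_reroot.
pose related n (ab : F * F) := exists v w : vertex T,
  [/\ l v = ab.1, l w = ab.2 & color n (sval v) = color n (sval w)].
have [n] : exists n, [set ab | `[< related n.+1 ab >]]
                   = [set ab | `[< related n ab >]].
  apply: (decreasing_set_stable (S := fun n => [set ab | `[< related n ab >]])).
  move=> n; apply/subsetP => ab; rewrite !inE.
  move=> /asboolP[v [w [va wb vw]]].
  by apply/asboolP; exists v, w; split=> //; exact: color_refine.
move=> stab; exists n => p q Rp Rq pq.
pose v : vertex T := exist _ p Rp; pose w : vertex T := exist _ q Rq.
have : (l v, l w) \in [set ab | `[< related n ab >]].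
  by rewrite inE; apply/asboolP; exists v, w.
rewrite -stab inE => /asboolP[v' [w' [v'v w'w v'w']]].
(* Vertices with equal labels have equal colours at every radius, so the witnesses [v'], [w'] may be
   replaced by [v], [w]. *)
exact: etrans (esym (l_color _ _ _ v'v)) (etrans v'w' (l_color _ _ _ w'w)).
Qed.

(** * Stable colours *)

Section Stable.
Hypothesis no_sink : forall v : vertex G, ~ sink v.
Variable N : nat.
Hypothesis colorN : forall p q, is_path p -> is_path q ->
  color N p = color N q -> color N.+1 p = color N.+1 q.

Lemma children_cat p q :
  children (p ++ q) =
  [seq p ++ rcons q e | e <- enum E & forg e == @path_end G (fend p) q].
Proof. by rewrite /children path_end_cat; apply: eq_map => e; rewrite rcons_cat. Qed.

Lemma neighbors_cat_rcons p q e :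
  neighbors (p ++ rcons q e) = (p ++ q) :: children (p ++ rcons q e).
Proof. by rewrite -rcons_cat neighbors_rcons. Qed.

(* Far below [p] and [p'], balls do not see which of the two paths was used. *)
Lemma color_cone_deep n p p' q :
  fend p = fend p' -> n <= size q -> color n (p ++ q) = color n (p' ++ q).
Proof.
move=> pp'; elim: n q => // n IH q; case/lastP: q => // q e.
rewrite size_rcons ltnS => nq; apply/colorS.
rewrite !neighbors_cat_rcons !children_cat /= IH // perm_cons -!map_comp pp'.
apply/permP=> a; congr (count a _); apply: eq_map => f /=.
by rewrite IH // !size_rcons leqW // leqW.
Qed.

Lemma color_path_end p p' :
  is_path p -> is_path p' -> fend p = fend p' -> color N p = color N p'.
Proof.
move=> Rp Rp' pp'.
(* Induction climbs from depth [N] towards the cone apex; [m] bounds how far [q] falls short of that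
   depth. *)
suff: forall m q, N <= size q + m -> is_path (p ++ q) ->
    color N (p ++ q) = color N (p' ++ q).
  by move/(_ N [::] (leqnn _)); rewrite !cats0; apply.
have path' r : is_path (p ++ r) -> is_path (p' ++ r).
  by move=> /path_from_cat[_ pr]; apply/path_from_cat; rewrite -[path_end _ _]pp'.
elim=> [|m IH] q; first by rewrite addn0 => Nq _; exact: color_cone_deep.
rewrite addnS -addSn => Nq Rq.
have [e eq] : exists e : E, forg e = @path_end G (fend p) q.
  apply: contrapT => no_e; apply: (no_sink (v := @path_end G (fend p) q)) => e eq.
  by apply: no_e; exists e.
have Rqe : is_path (p ++ rcons q e).
  rewrite -rcons_cat; apply/(path_from_rcons (G := G)); split=> //.
  by rewrite path_end_cat.
have : color N (p ++ rcons q e) = color N (p' ++ rcons q e).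
  by apply: IH; rewrite ?size_rcons.
move/(colorN Rqe (path' _ Rqe))/colorS.
rewrite !neighbors_cat_rcons /= !children_cat -!map_comp -pp'.
set s := map _ _; set s' := map _ _.
(* In the neighbourhood of the child along [e], the grandchildren agree by induction. Cancelling
   them leaves the colours of the two parents. *)
have -> : s = s'.
  apply/eq_in_map => f; rewrite mem_filter => /andP[/eqP fe _] /=.
  apply: IH; first by rewrite !size_rcons addSn; apply: leqW.
  rewrite -rcons_cat; apply/(path_from_rcons (G := G)); split=> //.
  by rewrite path_end_cat.
by rewrite -cat1s -[_ :: s']cat1s perm_cat2r => /perm_small_eq-/(_ isT)[].
Qed.

(** The ends of [p] and [p'] may differ. The extended paths have equal neighbour colours by
    stability and equal child colours by [color_path_end], so the remaining parent colours agree.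
    This gives condition (3). *)
Lemma color_parent p p' e e' :
  is_path (rcons p e) -> is_path (rcons p' e') -> fter e = fter e' ->
  color N p = color N p'.
Proof.
move=> Rp Rp' ee'.
have end_eq : fend (rcons p e) = fend (rcons p' e').
  by rewrite !path_end_rcons.
have := color_path_end Rp Rp' end_eq.
move/(colorN Rp Rp')/colorS; rewrite !neighbors_rcons /= /children -!map_comp.
rewrite -end_eq; set s := map _ _; set s' := map _ _.
have -> : s = s'.
  apply/eq_in_map => f; rewrite mem_filter => /andP[/eqP fe _] /=.
  apply: color_path_end; last by rewrite !path_end_rcons.
    exact/(path_from_rcons (G := G)).
  by apply/(path_from_rcons (G := G)); rewrite -end_eq.
by rewrite -cat1s -[_ :: s']cat1s perm_cat2r => /perm_small_eq-/(_ isT)[].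
Qed.

(** * From stable colours to an actual labelling *)

Hypothesis rootedR : @is_rooted G R.
Hypothesis no_pred : forall e : E, fter e <> R.

Lemma stable_color_actual_labelling : @has_actual_labelling G R.
Proof.
have /choice[P PP] := rootedR.
have RP v : is_path (P v) by case: (PP v).
have endP v : fend (P v) = v by case: (PP v).
pose lam v := color N (P v).
have lamE q : is_path q -> color N q = lam (fend q).
  by move=> Rq; apply: color_path_end => //; rewrite endP.
(* Colours are natural numbers but labels need a finite type, so each colour class is named by a
   canonical vertex in it. *)
pose l v := choose (fun w => lam w == lam v) v.
have lam_l v : lam (l v) = lam v.
  exact/eqP/(@chooseP _ (fun w => lam w == lam v) v)/eqxx.
have l_lam v w : lam v = lam w -> l v = l w.
  by move=> vw; rewrite /l vw; apply: choose_id => //; apply/eqP.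
pose nl p := [seq l (fend q) | q <- neighbors p].
have nl_color p q : is_path p -> is_path q ->
    color N p = color N q -> perm_eq (nl p) (nl q).
  have colE r : is_path r -> [seq color N r' | r' <- neighbors r] =
      [seq lam v | v <- [seq fend r' | r' <- neighbors r]].
    move=> Rr; rewrite -map_comp; apply/eq_in_map => r' /(neighbors_path Rr).
    exact: lamE.
  move=> Rp Rq /(colorN Rp Rq)/colorS; rewrite !colE // /nl.
  by move/(perm_map_factor l_lam); rewrite -!map_comp.
have out_image p : is_path p ->
    mset_image l (out_mset (fend p)) =
    seq_mset [seq l (fend q) | q <- children p].
  move=> Rp; apply/eq_seq_msetP.
  rewrite (permPl (perm_map _ (perm_eq_seq_mset _))) /children -!map_comp.
  rewrite (eq_map (g := l \o (@fter G))) // => e /=.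
  by rewrite path_end_rcons.
(* A colour is labelled by a chosen vertex of that colour. *)
exists (fvertex G), l, (fun v => l (fend (parent (P (val v))))),
  (fun x => seq_mset (nl (P x))).
(* The multiset is computed at the representative; stability transfers it to every vertex of the
   class. *)
have ME v : seq_mset (nl (P (l v))) = seq_mset (nl (P v)).
  by apply/eq_seq_msetP/nl_color => //; exact: lam_l.
split=> [[v vR]|] /=; last first.
  (* As no edge enters [R], its path is empty and its neighbours are exactly its children. *)
  rewrite ME; have PR : P R = [::].
    case/lastP: (P R) (endP R) => // p e; rewrite path_end_rcons.
    by move/no_pred.
  by rewrite PR -[RHS]/(seq_mset [seq _ | _ <- children [::]]) -out_image.
rewrite ME; case/lastP: (P v) (RP v) (endP v) => [|p e] Rpe ev.
  by case/eqP: vR; rewrite -ev.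
have nlE : seq_mset (nl (rcons p e)) =
    (l (fend p) +` seq_mset [seq l (fend q) | q <- children (rcons p e)])%mset.
  by rewrite /nl neighbors_rcons /= mset_cons.
rewrite nlE parent_rcons; split; first by rewrite mset1D1.
  by rewrite msetD1K -out_image // ev.
move=> f fv; apply: l_lam.
have [Rp _] := proj1 (path_from_rcons _ _ _) Rpe.
(* Prolonging the chosen path to the origin of [f] gives a second path to [v], whose parent can be
   compared with [p]. *)
have Rf : is_path (rcons (P (forg f)) f).
  by apply/(path_from_rcons (G := G)); split=> //; rewrite [RHS]endP.
rewrite -(lamE _ Rp); apply: (color_parent Rf Rpe).
by rewrite fv -[LHS]ev path_end_rcons.
Qed.

End Stable.

End Colors.

Theorem theorem1p3 (G : fin_digraph) (R : vertex G)
  (rootedR : is_rooted R)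
  (no_sink : forall v : vertex G, ~ sink v)
  (no_pred : forall e : edge G, ter e <> R)
  (coc : cocompact (unfolding_tree R)) :
  has_actual_labelling R.
Proof.
have [N colorN] := cocompact_color_stable coc.
exact (stable_color_actual_labelling no_sink colorN rootedR no_pred).
Qed.
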